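(* Let $n\ge 1$. Let $(\Lambda_m)_{m\ge1}$ be a sequence of elements of $\mathcal{UD}$ such that the sequence $(\chi_{\mathcal{B}(\Lambda_m)})_{m\ge1}$ is a Cauchy sequence for the pseudo-metric associated with $\|\cdot\|_1$ on $\mathcal{L}^1_{loc}\cap\mathcal{L}^\infty$. Then there exist (i) a strictly increasing sequence of positive integers $(m_i)_{i\ge1}$, and (ii) a strictly increasing sequence of real numbers $(\lambda_i)_{i\ge1}$ with $\lambda_i\ge1$ and $\lambda_{i+1}>2\lambda_i$ for all $i\geq 1$, such that, with $$\Lambda=\bigcup_{i\ge1}\Lambda_{m_i}\cap\mathcal{C}(\lambda_i+1/2,\ \lambda_{i+1}-1/2),$$ the two functions $\chi_{\mathcal{B}(\Lambda)}$ and $\lim_{i\to+\infty}\chi_{\mathcal{B}(\Lambda_{m_i})}$ (limit with respect to $\|\cdot\|_1$) are $\mathcal{M}^1$-equivalent. As a consequence, $$\delta(\mathcal{B}(\Lambda))=\lim_{i\to+\infty}\delta(\mathcal{B}(\Lambda_{m_i})).$$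
   Context: $B(c,t)$ is the closed ball of $\mathbb{R}^n$ with center $c$ and radius $t$, and $B=B(0,1/2)$. For $0\le\lambda\le\mu$, $\mathcal{C}(\lambda,\mu)=\{x\in\mathbb{R}^n:\lambda\le\|x\|\le\mu\}$. $\mathcal{UD}$ is the set of all uniformly discrete subsets of $\mathbb{R}^n$ of constant $1$, i.e. subsets $\Lambda$ with $\|x-y\|\ge 1$ for all distinct $x,y\in\Lambda$ (the empty set and finite sets are included). For $\Lambda\in\mathcal{UD}$, $\mathcal{B}(\Lambda)=\{\lambda+B:\lambda\in\Lambda\}$ is the associated packing of balls of radius $1/2$, $\chi_{\mathcal{B}(\Lambda)}$ is the characteristic function of the union of these balls, and the density is $$\delta(\mathcal{B}(\Lambda))=\limsup_{T\to+\infty}\frac{\mathrm{vol}\big((\bigcup_{\lambda\in\Lambda}(\lambda+B))\cap B(0,T)\big)}{\mathrm{vol}(B(0,T))}.$$ $\mathcal{L}^1_{loc}$ is the space of complex-valued functions on $\mathbb{R}^n$ whose absolute value is Lebesgue integrable over every bounded measurable subset; $\mathcal{L}^\infty$ denotes the bounded ones. For $f\in\mathcal{L}^1_{loc}$, $\|f\|_1:=\limsup_{t\to+\infty}\frac{1}{\mathrm{vol}(tB)}\int_{tB}|f(x)|\,dx$. Two functions $f,g$ are $\mathcal{M}^1$-equivalent (Marcinkiewicz equivalent) if $\|f-g\|_1=0$. A limit with respect to $\|\cdot\|_1$ is determined up to this equivalence, so the equivalence asserted means $\lim_{i\to+\infty}\|\chi_{\mathcal{B}(\Lambda)}-\chi_{\mathcal{B}(\Lambda_{m_i})}\|_1=0$.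 *)

(* Defs.v *)
From HB Require Import structures.
From mathcomp Require Import all_boot all_order all_algebra.
From mathcomp Require Import complex.
From mathcomp Require Import all_classical all_reals all_analysis.

Set Implicit Arguments.
Unset Strict Implicit.
Unset Printing Implicit Defensive.
Import Order.TTheory GRing.Theory Num.Theory.
Import numFieldNormedType.Exports.
Local Open Scope classical_set_scope.
Local Open Scope ring_scope.

(* Measurable structure on 'rV[R]_n: the sigma-algebra generated by the        *)
(* coordinates, i.e. the Borel sigma-algebra of R^n.                           *)
Section row_measurable.
Variables (R : realType) (n : nat).

Let coord (i : 'I_n) (x : 'rV[R]_n) : measurableTypeR R := x 0 i.

Let row_set0 : g_sigma_preimage coord set0.
Proof. exact: sigma_algebra0. Qed.

Let row_setC A : g_sigma_preimage coord A -> g_sigma_preimage coord (~` A).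
Proof. exact: sigma_algebraC. Qed.

Let row_bigcup (F : (set 'rV[R]_n)^nat) :
  (forall i, g_sigma_preimage coord (F i)) ->
  g_sigma_preimage coord (\bigcup_i (F i)).
Proof. exact: sigma_algebra_bigcup. Qed.

HB.instance Definition _ := @isMeasurable.Build default_measure_display
  'rV[R]_n (g_sigma_preimage coord) row_set0 row_setC row_bigcup.

Lemma measurable_coord (i : 'I_n) :
  measurable_fun setT (fun x : 'rV[R]_n => x 0 i : measurableTypeR R).
Proof.
move=> _ Y mY; rewrite setTI; apply: sub_sigma_algebra => /=.
rewrite -bigcup_seq/=; exists i => /=; first by rewrite mem_index_enum.
by exists Y => //; rewrite setTI.
Qed.

Lemma measurable_rowP d (T : measurableType d) (f : T -> 'rV[R]_n) :
  (forall i, measurable_fun setT (fun t => f t 0 i : measurableTypeR R)) ->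
  measurable_fun setT f.
Proof.
move=> mf.
suff sf : g_sigma_preimage (fun i => coord i \o f) `<=` measurable.
  by move=> _ A mA; apply: sf; rewrite g_sigma_preimage_comp; exists A.
apply: smallest_sub; first exact: sigma_algebra_measurable.
rewrite -bigcup_seq; apply: bigcup_sub => i _ _ [B mB <-].
exact: (mf i).
Qed.

End row_measurable.

Section lebesgue_row.
Variable R : realType.

Definition row_cons n (p : measurableTypeR R * 'rV[R]_n) : 'rV[R]_n.+1 :=
  \row_i (if unlift ord0 i is Some j then p.2 0 j else p.1).

Definition row_uncons n (x : 'rV[R]_n.+1) : measurableTypeR R * 'rV[R]_n :=
  (x 0 ord0, \row_j x 0 (lift ord0 j)).

Lemma row_consK n : cancel (@row_cons n) (@row_uncons n).
Proof.
case=> a y; rewrite /row_uncons /row_cons mxE unlift_none /=; congr pair.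
by apply/rowP => j; rewrite !mxE liftK.
Qed.

Lemma row_unconsK n : cancel (@row_uncons n) (@row_cons n).
Proof.
move=> x; apply/rowP => i; rewrite mxE.
by case: unliftP => [j|] ->; rewrite /= ?mxE.
Qed.

Lemma measurable_row_cons n : measurable_fun setT (@row_cons n).
Proof.
apply: measurable_rowP => i; rewrite /row_cons.
case: (unliftP ord0 i) => [j|] ij.
  rewrite (_ : (fun _ => _) =
      (fun x : 'rV[R]_n => x 0 j : measurableTypeR R) \o snd).
    exact: measurableT_comp (measurable_coord j) measurable_snd.
  by apply/funext => p /=; rewrite mxE ij liftK.
rewrite (_ : (fun _ => _) = fst); first exact: measurable_fst.
by apply/funext => p /=; rewrite mxE ij unlift_none.
Qed.

Lemma measurable_row_uncons n : measurable_fun setT (@row_uncons n).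
Proof.
apply/measurable_fun_pairP; split; first exact: measurable_coord.
apply: measurable_rowP => j.
rewrite (_ : (fun _ => _) =
    fun x : 'rV[R]_n.+1 => x 0 (lift ord0 j) : measurableTypeR R).
  exact: measurable_coord.
by apply/funext => x /=; rewrite mxE.
Qed.

Section step.
Variables (n : nat) (mu : {sigma_finite_measure set 'rV[R]_n -> \bar R}).

Definition lebesgue_step : set 'rV[R]_n.+1 -> \bar R :=
  pushforward (@lebesgue_measure R \x mu)%E (@row_cons n).

Let step0 : lebesgue_step set0 = 0%E.
Proof. by rewrite /lebesgue_step /pushforward preimage_set0 measure0. Qed.

Let step_ge0 A : (0 <= lebesgue_step A)%E.
Proof. by rewrite /lebesgue_step /pushforward; exact: measure_ge0. Qed.

Let step_sigma_additive : semi_sigma_additive lebesgue_step.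
Proof.
have mc A : measurable A -> measurable (@row_cons n @^-1` A).
  by move=> mA; rewrite -[X in measurable X]setTI; exact: measurable_row_cons.
move=> F mF tF mUF; rewrite /lebesgue_step /pushforward preimage_bigcup.
apply: measure_semi_sigma_additive; first by move=> k; exact: mc.
- apply/trivIsetP => /= i j _ _ ij; rewrite -preimage_setI.
  by move/trivIsetP : tF => /(_ _ _ _ _ ij) ->//; rewrite preimage_set0.
- by rewrite -preimage_bigcup; exact: mc.
Qed.

HB.instance Definition _ := isMeasure.Build _ _ _ lebesgue_step
  step0 step_ge0 step_sigma_additive.

Let step_sigma_finite : sigma_finite setT lebesgue_step.
Proof.
have /sigma_finiteP[F [TF ndF Foo]] := sigma_finiteT (@lebesgue_measure R).
have /sigma_finiteP[G [TG ndG Goo]] := sigma_finiteT mu.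
exists (fun k => @row_uncons n @^-1` (F k `*` G k)).
  rewrite -preimage_bigcup predeqE => x; split => // _.
  have [i _ Fi] : (\bigcup_i F i) (row_uncons x).1 by rewrite -TF.
  have [j _ Gj] : (\bigcup_i G i) (row_uncons x).2 by rewrite -TG.
  exists (maxn i j) => //; split.
    by move: Fi; exact/subsetPset/ndF/leq_maxl.
  by move: Gj; exact/subsetPset/ndG/leq_maxr.
move=> k; have [mF Fk] := Foo k; have [mG Gk] := Goo k; split.
  rewrite -[X in measurable X]setTI; apply: measurable_row_uncons => //.
  exact: measurableX.
rewrite /lebesgue_step /pushforward -comp_preimage.
rewrite (_ : _ \o _ = id); last by apply/funext => p /=; rewrite row_consK.
by rewrite preimage_id product_measure1E// lte_mul_pinfty// ge0_fin_numE.
Qed.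

HB.instance Definition _ := Measure_isSigmaFinite.Build _ _ _ lebesgue_step
  step_sigma_finite.

End step.

(* n-dimensional Lebesgue measure, on Borel sets: the n-fold product of the    *)
(* Lebesgue measure of the line.                                               *)
Fixpoint vol n : {sigma_finite_measure set 'rV[R]_n -> \bar R} :=
  if n is m.+1 then lebesgue_step (vol m) else dirac (0 : 'rV[R]_0).

Lemma vol_box n (A : 'I_n -> set (measurableTypeR R)) :
  (forall i, measurable (A i)) ->
  vol n [set x | forall i, A i (x 0 i)] = (\prod_i lebesgue_measure (A i))%E.
Proof.
elim: n A => [|n IHn] A mA.
  by rewrite big_ord0 /= diracE mem_set// => -[].
pose A' j := A (lift ord0 j).
have mA' : measurable [set y : 'rV[R]_n | forall j, A' j (y 0 j)].
  rewrite (_ : [set _ | _] = \bigcap_j ((fun y : 'rV[R]_n => y 0 j) @^-1` A' j)).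
    apply: fin_bigcap_measurable => // j _; rewrite -[X in measurable X]setTI.
    by apply: measurable_coord => //; exact: mA.
  by apply/seteqP; split => [y /= + j _|y /= + j]; exact.
rewrite big_ord_recl -(IHn A') => [|j]; last exact: mA.
rewrite -product_measure1E//.
congr (product_measure1 _ _ _).
apply/seteqP; split => [[t y] /= Aty|[t y] /= [At Ay] i].
  split; first by have := Aty ord0; rewrite mxE unlift_none.
  by move=> j; have := Aty (lift ord0 j); rewrite mxE liftK.
by rewrite mxE; case: unliftP => [j|] ->; [exact: Ay|].
Qed.

End lebesgue_row.

Section packings.
Variables (R : realType) (n : nat).
Notation E := 'rV[R]_n.

(* The Euclidean norm; the library norm `|x| on 'rV[R]_n is the sup norm. *)
Definition enorm (x : E) : R := Num.sqrt (\sum_i x 0 i ^+ 2).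

Definition cball (c : E) (t : R) : set E := [set x | enorm (x - c) <= t].

Definition annulus (a b : R) : set E := [set x | a <= enorm x <= b].

Definition halfball : set E := cball 0 2^-1.

Definition uniformly_discrete (L : set E) :=
  forall x y, L x -> L y -> x != y -> 1 <= enorm (x - y).

Definition packing (L : set E) : set (set E) :=
  [set +%R l @` halfball | l in L].

Definition support_set (P : set (set E)) : set E := \bigcup_(b in P) b.

Definition chi (P : set (set E)) : E -> R[i] :=
  fun x => ((\1_(support_set P) x : R)%:C)%C.

Definition density (P : set (set E)) : \bar R :=
  limf_esup (fun T : R =>
    vol R n (support_set P `&` cball 0 T) / vol R n (cball 0 T))%E +oo.

Definition M1norm (f : E -> R[i]) : \bar R :=
  limf_esup (fun t : R =>
    (vol R n ( *:%R t @` halfball))^-1 *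
      \int[vol R n]_(x in *:%R t @` halfball) (Normc.normc (f x))%:E)%E +oo.

Definition M1_cauchy (u : nat -> E -> R[i]) :=
  forall e : R, 0 < e -> exists N, forall p q, (N <= p)%N -> (N <= q)%N ->
    (M1norm (u p \- u q)%R < e%:E)%E.

End packings.

(* Main.v *)
(* Pass to a subsequence m_i with M1-distance at most 2^-i between the i-th term and
   all later ones, and choose radii lam_i so large that B(0, lam_i + 1) is a
   negligible part of B(0, lam_(i+1)), and that beyond radius lam_j the
   symmetric difference of the packings of index i <= j fills at most a fraction
   2^-i of a ball.  For lam_(k+1) <= T <= lam_(k+2), the glued packing then differs
   from the i-th one inside B(0, T) only on B(0, lam_k + 1), on the symmetric
   differences of index (k, i) and (k+1, i), and on two shells of bounded width,
   at radius lam_(k+1) and at the boundary of B(0, T).  Only the last two radii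
   intervene, so the errors do not accumulate.  The shells are negligible
   because vol B(0, T) is proportional to T^n.  Finally the density is
   1-Lipschitz for the M1 pseudo-metric. *)
Require Import Defs.
From mathcomp Require Import all_boot all_order all_algebra.
From mathcomp Require Import complex ring lra.
From mathcomp Require Import all_classical all_reals all_analysis.
From mathcomp Require Import measurable_realfun.

Set Implicit Arguments.
Unset Strict Implicit.
Unset Printing Implicit Defensive.
Import Order.TTheory GRing.Theory Num.Theory.
Import numFieldNormedType.Exports.
Local Open Scope classical_set_scope.
Local Open Scope ring_scope.

(** * The Euclidean norm and its closed balls *)

Section euclidean_norm.
Context {R : realType} {n : nat}.
Implicit Types x y : 'rV[R]_n.

Lemma enorm_ge0 x : 0 <= enorm x.
Proof. exact: sqrtr_ge0. Qed.

Lemma sqr_enorm x : enorm x ^+ 2 = \sum_i x 0 i ^+ 2.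
Proof. by rewrite sqr_sqrtr// sumr_ge0// => i _; exact: sqr_ge0. Qed.

Lemma enormZ a x : enorm (a *: x) = `|a| * enorm x.
Proof.
rewrite /enorm -sqrtr_sqr -sqrtrM ?sqr_ge0// mulr_sumr.
by congr Num.sqrt; apply: eq_bigr => i _; rewrite mxE exprMn.
Qed.

Lemma enormN x : enorm (- x) = enorm x.
Proof. by rewrite -scaleN1r enormZ normrN1 mul1r. Qed.

Lemma coord_le_enorm x i : `|x 0 i| <= enorm x.
Proof.
rewrite -sqrtr_sqr ler_wsqrtr// (bigD1 i)//= lerDl.
by apply: sumr_ge0 => j _; exact: sqr_ge0.
Qed.

(** After squaring, each [x 0 i ^+ 2] is at most [|x 0 i|] times the whole sum. *)
Lemma enorm_le_sum x : enorm x <= \sum_i `|x 0 i|.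
Proof.
have s0 : 0 <= \sum_i `|x 0 i| by apply: sumr_ge0.
rewrite -[leRHS](ger0_norm s0) -sqrtr_sqr ler_wsqrtr// expr2 mulr_suml.
apply: ler_sum => i _; rewrite -real_normK ?num_real// expr2.
by rewrite ler_wpM2l// (bigD1 i)//= lerDl sumr_ge0.
Qed.

(** For nonzero norms, expand the squared norm of [enorm y *: x - enorm x *: y], which is
    nonnegative, and divide by [enorm x * enorm y]. *)
Lemma cauchy_schwarz x y : \sum_i x 0 i * y 0 i <= enorm x * enorm y.
Proof.
have [y0|yn0] := eqVneq (enorm y) 0.
  rewrite y0 mulr0 big1// => i _.
  have := coord_le_enorm y i; rewrite y0 normr_le0 => /eqP ->.
  by rewrite mulr0.
have [x0|xn0] := eqVneq (enorm x) 0.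
  rewrite x0 mul0r big1// => i _.
  have := coord_le_enorm x i; rewrite x0 normr_le0 => /eqP ->.
  by rewrite mul0r.
have xy0 : 0 < enorm x * enorm y by rewrite mulr_gt0// lt_def enorm_ge0 ?xn0 ?yn0.
have : 0 <= \sum_i (enorm y * x 0 i - enorm x * y 0 i) ^+ 2.
  by apply: sumr_ge0 => i _; exact: sqr_ge0.
rewrite (eq_bigr (fun i => enorm y ^+ 2 * x 0 i ^+ 2 + enorm x ^+ 2 * y 0 i ^+ 2
   + - (2 * (enorm x * enorm y)) * (x 0 i * y 0 i))); last by move=> i _; ring.
rewrite !big_split/= -!mulr_sumr -!sqr_enorm => h.
rewrite -(ler_pM2l xy0); nra.
Qed.

Lemma enormD x y : enorm (x + y) <= enorm x + enorm y.
Proof.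
rewrite -(@ler_pXn2r _ 2)// ?nnegrE ?addr_ge0 ?enorm_ge0//.
rewrite sqr_enorm (eq_bigr (fun i => x 0 i ^+ 2 + y 0 i ^+ 2
   + 2 * (x 0 i * y 0 i))); last by move=> i _; rewrite mxE; ring.
rewrite !big_split/= -!mulr_sumr -!sqr_enorm.
have := cauchy_schwarz x y; nra.
Qed.

Lemma enormB_ge x y : enorm x - enorm y <= enorm (x - y).
Proof. by rewrite lerBlDr -{1}(subrK y x) enormD. Qed.

Lemma measurable_enorm (c : 'rV[R]_n) :
  measurable_fun setT (fun x => enorm (x - c) : measurableTypeR R).
Proof.
have -> : (fun x => enorm (x - c)) =
    Num.sqrt \o (fun x => \sum_i (x 0 i - c 0 i) ^+ 2).
  by apply/funext => x; rewrite /enorm/=; congr Num.sqrt; apply: eq_bigr => i _; rewrite !mxE.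
apply: measurableT_comp.
  by apply: continuous_measurable_fun; exact: sqrt_continuous.
apply: measurable_sum => i; apply: measurable_funX.
apply: measurable_funB; [exact: measurable_coord|exact: measurable_cst].
Qed.

Lemma measurable_cball (c : 'rV[R]_n) t : measurable (cball c t).
Proof.
have -> : cball c t = (fun x => enorm (x - c)) @^-1` `]-oo, t].
  by apply/seteqP; split => x; rewrite /cball/= in_itv.
by rewrite -[X in measurable X]setTI; apply: measurable_enorm.
Qed.

Lemma cball0E t : cball 0 t = [set x : 'rV[R]_n | enorm x <= t].
Proof. by apply/seteqP; split => x; rewrite /cball/= subr0. Qed.

Lemma subset_cball0 s t : s <= t -> cball (0 : 'rV[R]_n) s `<=` cball 0 t.
Proof. by move=> st x /le_trans; exact. Qed.

Lemma scale_halfball t : 0 < t ->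
  *:%R t @` @halfball R n = cball 0 (t / 2).
Proof.
move=> t0; rewrite /halfball !cball0E; apply/seteqP; split => x /=.
  by case=> y yh <-; rewrite enormZ gtr0_norm// ler_wpM2l// ltW.
move=> xt; exists (t^-1 *: x); last by rewrite scalerA divff ?gt_eqF// scale1r.
by rewrite enormZ gtr0_norm ?invr_gt0// ler_pdivrMl.
Qed.

End euclidean_norm.

(* The canonical measure structure of a pushforward takes the measurability of the
   map as an argument that unification cannot find, hence the explicit projection. *)
Section scaled_image.
Context d1 d2 (T1 : measurableType d1) (T2 : measurableType d2) (R : realType).
Variables (k : {nonneg R}) (m : {measure set T1 -> \bar R}) (f : T1 -> T2).
Hypothesis mf : measurable_fun setT f.

Definition scaled_image : {measure set T2 -> \bar R} :=
  mscale k (measure_function_pushforward__canonical__measure_function_Measure m mf).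

Lemma scaled_imageE A : scaled_image A = (k%:num%:E * m (f @^-1` A))%E.
Proof. by []. Qed.

End scaled_image.
Arguments scaled_image {d1 d2 T1 T2 R} k m {f} mf.

(** * Lebesgue measure under homotheties *)

Section scaling.
Context {R : realType}.

Lemma measurable_row_scale n (a : R) :
  measurable_fun setT ( *:%R a : 'rV[R]_n -> 'rV[R]_n).
Proof.
apply: measurable_rowP => i.
rewrite (_ : (fun _ => _) = (fun x : 'rV[R]_n => a * x 0 i)).
  by apply: measurable_funM; [exact: measurable_cst|exact: measurable_coord].
by apply/funext => x; rewrite mxE.
Qed.

Lemma measurable_scaleR (a : R) :
  measurable_fun setT ( *%R a : measurableTypeR R -> measurableTypeR R).
Proof. by apply: measurable_funM; [exact: measurable_cst|exact: measurable_id]. Qed.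

(** The image of Lebesgue measure under division by [r], multiplied by [r^-1], agrees with Lebesgue
    measure on half-open intervals, hence everywhere. *)
Lemma lebesgue_measure_scale (r : R) (A : set (measurableTypeR R)) :
  0 < r -> measurable A ->
  lebesgue_measure ( *%R r^-1 @^-1` A) = (r%:E * lebesgue_measure A)%E.
Proof.
move=> r0 mA; have ri0 : 0 <= r^-1 by rewrite invr_ge0 ltW.
pose h := ( *%R r^-1 : measurableTypeR R -> measurableTypeR R).
have mh : measurable_fun setT h by exact: measurable_scaleR.
have -> : lebesgue_measure A =
    scaled_image (NngNum ri0) lebesgue_measure mh A.
  apply: lebesgue_measure_unique => // _ [[a b]] _ <-.
  rewrite scaled_imageE /=.
  have -> : h @^-1` `]a, b]%classic = `](r * a)%R, (r * b)%R]%classic.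
    apply/seteqP; split => x; rewrite /= /h !in_itv/= ltr_pdivlMl// ler_pdivrMl//.
  rewrite !lebesgue_measure_itv/= !lte_fin ltr_pM2l//.
  case: ifPn => ab; last by rewrite mule0.
  by rewrite -!EFinB -EFinM -mulrBr mulKf ?gt_eqF.
by rewrite scaled_imageE /= muleA -EFinM divff ?gt_eqF// mul1e.
Qed.

(* By uniqueness of the product measure, one coordinate at a time. *)
Lemma vol_scale n (r : R) (A : set 'rV[R]_n) : 0 < r -> measurable A ->
  vol R n ( *:%R r^-1 @^-1` A) = ((r ^+ n)%:E * vol R n A)%E.
Proof.
move=> r0; elim: n A => [|n IHn] A mA.
  rewrite expr0 mul1e (_ : _ @^-1` A = A)//.
  by apply/seteqP; split => x /=; rewrite [_ *: x]thinmx0 [x]thinmx0.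
have ri0 : 0 <= (r ^+ n.+1)^-1 by rewrite invr_ge0 exprn_ge0// ltW.
pose h (p : measurableTypeR R * 'rV[R]_n) : measurableTypeR R * 'rV[R]_n :=
  (r^-1 * p.1, r^-1 *: p.2).
have mh : measurable_fun setT h.
  apply/measurable_fun_pairP; split.
    by apply: measurableT_comp measurable_fst; exact: measurable_scaleR.
  by apply: measurableT_comp measurable_snd; exact: measurable_row_scale.
have mcA : measurable (@row_cons R n @^-1` A).
  by rewrite -[X in measurable X]setTI; exact: measurable_row_cons.
(* [row_cons] intertwines [h] with the homothety of rows, so the claim moves to the product
   space. *)
have -> : vol R n.+1 ( *:%R r^-1 @^-1` A) =
    (lebesgue_measure \x vol R n)%E (h @^-1` (@row_cons R n @^-1` A)).
  rewrite /= /lebesgue_step /pushforward; congr (_ _).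
  apply/seteqP; split => -[a y] /=;
    rewrite (_ : _ *: row_cons (a, y) = row_cons (h (a, y)))//;
    apply/rowP => i; rewrite !mxE/=; case: unlift => //= j; by rewrite mxE.
have -> : vol R n.+1 A =
    scaled_image (NngNum ri0) (lebesgue_measure \x vol R n)%E mh
      (@row_cons R n @^-1` A).
  rewrite -(product_measure_unique (m1 := lebesgue_measure) (m2 := vol R n)) //.
  move=> B C mB mC; rewrite scaled_imageE /=.
  have -> : h @^-1` (B `*` C) = ( *%R r^-1 @^-1` B) `*` ( *:%R r^-1 @^-1` C) by [].
  have mB' : measurable ( *%R r^-1 @^-1` B).
    by rewrite -[X in measurable X]setTI; exact: measurable_scaleR.
  have mC' : measurable ( *:%R r^-1 @^-1` C).
    by rewrite -[X in measurable X]setTI; exact: measurable_row_scale.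
  rewrite product_measure1E//.
  transitivity ((r^-1 ^+ n.+1)%:E *
      ((r%:E * lebesgue_measure B) * ((r ^+ n)%:E * vol R n C)))%E.
    rewrite exprVn; congr (_ * (_ * _))%E; last exact: IHn.
    exact: lebesgue_measure_scale.
  rewrite muleACA -EFinM [LHS]muleA -EFinM -exprS exprVn mulVf ?mul1e//.
  by rewrite expf_neq0// gt_eqF.
by rewrite scaled_imageE /= muleA -EFinM divff ?mul1e// expf_neq0// gt_eqF.
Qed.

End scaling.

(** * Volume of Euclidean balls *)

Section ball_volume.
Context {R : realType} {n : nat}.

Lemma vol_cball_scale (t : R) : 0 < t ->
  vol R n (cball 0 t) = ((t ^+ n)%:E * vol R n (cball 0 1))%E.
Proof.
move=> t0; rewrite -vol_scale//; last exact: measurable_cball.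
congr (vol R n _); rewrite !cball0E; apply/seteqP; split => x /=;
  by rewrite enormZ gtr0_norm ?invr_gt0// ler_pdivrMl// mulr1.
Qed.

Lemma measurable_cube (A : set (measurableTypeR R)) : measurable A ->
  measurable [set x : 'rV[R]_n | forall i, A (x 0 i)].
Proof.
move=> mA; have -> : [set x : 'rV[R]_n | forall i, A (x 0 i)] =
    \bigcap_i ((fun y : 'rV[R]_n => y 0 i) @^-1` A).
  by apply/seteqP; split => [y /= + i _|y /= + i]; exact.
apply: fin_bigcap_measurable => // i _; rewrite -[X in measurable X]setTI.
exact: measurable_coord.
Qed.

(** The unit ball lies in a cube of side 2. *)
Lemma vol_cball1_fin : vol R n (cball 0 1) \is a fin_num.
Proof.
rewrite ge0_fin_numE//.
apply: (@le_lt_trans _ _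
    (vol R n [set x | forall i, `[(-1)%R, 1%R]%classic (x 0 i)])).
  apply: le_measure; rewrite ?inE; [exact: measurable_cball| |].
    by apply: measurable_cube; exact: measurable_itv.
  move=> x; rewrite cball0E /= => x1 i.
  by rewrite in_itv/= -ler_norml (le_trans (coord_le_enorm x i)).
rewrite (vol_box (A := fun=> `[(-1)%R, 1%R]%classic))//.
rewrite -ge0_fin_numE; last by apply: prode_ge0 => i _; exact: measure_ge0.
by apply: prode_fin_num => i _; rewrite lebesgue_measure_itv/= lte_fin; case: ifP.
Qed.

Lemma vol_cball1_gt0 : (0 < vol R n (cball 0 1))%E.
Proof.
(* In the cube of half-side [a] the coordinates sum to at most n/(n+1) in absolute value, so it lies
   in the unit ball; n+1 also covers n = 0. *)
pose a : R := n.+1%:R^-1; have a0 : 0 < a by rewrite invr_gt0.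
have mA : measurable (`[(- a)%R, a]%classic : set (measurableTypeR R)).
  exact: measurable_itv.
apply: (@lt_le_trans _ _ (vol R n [set x | forall i, `[(- a)%R, a]%classic (x 0 i)])).
  rewrite (vol_box (A := fun=> `[(- a)%R, a]%classic))//.
  rewrite (eq_bigr (fun=> (a + a)%:E)) => [|i _].
    elim/big_ind : _ => //; last by move=> i _; rewrite lte_fin addr_gt0.
    by move=> x y; exact: mule_gt0.
  rewrite lebesgue_measure_itv/= lte_fin ifT ?opprK//.
  by rewrite (lt_trans _ a0)// oppr_lt0.
apply: le_measure; rewrite ?inE; [|exact: measurable_cball|].
  exact: measurable_cube.
move=> x /= xa; rewrite cball0E/=; apply: (le_trans (enorm_le_sum x)).
apply: (@le_trans _ _ (\sum_(i < n) a)).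
  by apply: ler_sum => i _; have := xa i; rewrite /= in_itv/= ler_norml.
by rewrite sumr_const card_ord -mulr_natl ler_pdivrMr// mul1r ler_nat.
Qed.

End ball_volume.

(** * Fraction of a centered ball filled by a set *)

Section ball_ratio.
Context {R : realType} {n : nat}.
Implicit Types (A B : set 'rV[R]_n) (t : R).

(** Real-valued so that ordinary arithmetic applies; [vol_div_cball] identifies it with the
    extended-real quotient for positive radii. *)
Definition ball_ratio A t : R :=
  fine (vol R n (A `&` cball 0 t)) / fine (vol R n (cball 0 t)).

Lemma vol_cball_fin t : 0 < t -> vol R n (cball 0 t) \is a fin_num.
Proof. by move=> t0; rewrite vol_cball_scale// fin_numM// vol_cball1_fin. Qed.

Lemma fine_vol_cball t : 0 < t ->
  fine (vol R n (cball 0 t)) = t ^+ n * fine (vol R n (cball 0 1)).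
Proof. by move=> t0; rewrite vol_cball_scale// fineM// vol_cball1_fin. Qed.

Lemma fine_vol_cball_gt0 t : 0 < t -> 0 < fine (vol R n (cball 0 t)).
Proof.
move=> t0; rewrite fine_vol_cball// mulr_gt0 ?exprn_gt0//.
by rewrite fine_gt0// vol_cball1_gt0 -ge0_fin_numE// vol_cball1_fin.
Qed.

Lemma vol_setI_cball_fin A t : measurable A -> 0 < t ->
  vol R n (A `&` cball 0 t) \is a fin_num.
Proof.
move=> mA t0; have := vol_cball_fin t0; rewrite ge0_fin_numE// => voo.
rewrite ge0_fin_numE// (le_lt_trans _ voo)// le_measure ?inE//.
- by apply: measurableI => //; exact: measurable_cball.
- exact: measurable_cball.
Qed.

Lemma vol_div_cball A t : measurable A -> 0 < t ->
  (vol R n (A `&` cball 0 t) / vol R n (cball 0 t))%E = (ball_ratio A t)%:E.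
Proof.
move=> mA t0; rewrite -(fineK (vol_setI_cball_fin mA t0)) -(fineK (vol_cball_fin t0)).
by rewrite inver gt_eqF ?fine_vol_cball_gt0// -EFinM.
Qed.

Lemma le_ball_ratio A B t : measurable A -> measurable B -> 0 < t ->
  A `&` cball 0 t `<=` B -> ball_ratio A t <= ball_ratio B t.
Proof.
move=> mA mB t0 AB; rewrite ler_wpM2r ?invr_ge0 ?fine_ge0//.
have mc := @measurable_cball R n 0 t.
rewrite fine_le ?vol_setI_cball_fin// le_measure ?inE//; try exact: measurableI.
by move=> x [Ax tx]; split=> //; exact: AB.
Qed.

Lemma ball_ratioU A B t : measurable A -> measurable B -> 0 < t ->
  ball_ratio (A `|` B) t <= ball_ratio A t + ball_ratio B t.
Proof.
move=> mA mB t0; rewrite -mulrDl ler_wpM2r ?invr_ge0 ?fine_ge0//.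
have mc := @measurable_cball R n 0 t.
rewrite -fineD ?vol_setI_cball_fin// fine_le ?vol_setI_cball_fin//.
- exact: measurableU.
- by rewrite fin_numD !vol_setI_cball_fin.
- by rewrite setIUl measureU2//; exact: measurableI.
Qed.

Lemma ball_ratio_le1 A t : measurable A -> 0 < t -> ball_ratio A t <= 1.
Proof.
move=> mA t0; rewrite ler_pdivrMr ?fine_vol_cball_gt0// mul1r.
have mc := @measurable_cball R n 0 t.
rewrite fine_le ?vol_setI_cball_fin ?vol_cball_fin// le_measure ?inE//.
exact: measurableI.
Qed.

Lemma ball_ratio_cball s t : 0 < s <= t ->
  ball_ratio (cball 0 s) t = (s / t) ^+ n.
Proof.
move=> /andP[s0 st]; have t0 := lt_le_trans s0 st.
rewrite /ball_ratio setIidl; last exact: subset_cball0.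
rewrite fine_vol_cball// [X in _ / X]fine_vol_cball//.
rewrite -mulf_div divff ?mulr1 ?expr_div_n//.
by rewrite gt_eqF// fine_vol_cball_gt0.
Qed.

Lemma ball_ratio_shell r s t : 0 < r <= s -> s <= t ->
  ball_ratio (cball 0 s `\` cball 0 r) t = (s / t) ^+ n - (r / t) ^+ n.
Proof.
move=> /andP[r0 rs] st; have s0 := lt_le_trans r0 rs; have t0 := lt_le_trans s0 st.
rewrite -ball_ratio_cball ?s0// -ball_ratio_cball ?r0 ?(le_trans rs)//.
rewrite /ball_ratio -mulrBl; congr (_ / _).
have mc u := @measurable_cball R n 0 u.
rewrite -fineB ?vol_setI_cball_fin//; congr fine.
rewrite [X in vol R n X](_ : _ = (cball 0 s `&` cball 0 t) `\` cball 0 r); last first.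
  by apply/seteqP; split => x /=; tauto.
rewrite measureD//=; [|exact: measurableI|by rewrite -ge0_fin_numE// vol_setI_cball_fin].
congr (_ - vol R n _)%E; apply/seteqP; split => x [] //.
- by move=> [].
- by move=> xr xt; split=> //; split=> //; apply: subset_cball0 xr.
Qed.

End ball_ratio.

(** * Measurability of packings *)

Section packing_support.
Context {R : realType} {n : nat}.
Implicit Types (L : set 'rV[R]_n) (x : 'rV[R]_n).

Lemma support_setE L :
  support_set (packing L) = \bigcup_(l in L) cball l 2^-1.
Proof.
rewrite /support_set /packing bigcup_image; apply: eq_bigcupr => l _.
rewrite /halfball cball0E; apply/seteqP; split => x /=.
  by case=> y yh <-; rewrite /cball/= addrC addKr.
by rewrite /cball/= => xl; exists (x - l) => //; rewrite addrC subrK.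
Qed.

(* Points at distance at least 1 have distinct integer parts after scaling by n + 1. *)
Lemma countable_uniformly_discrete L : uniformly_discrete L -> countable L.
Proof.
move=> uL; pose f x := pickle [ffun i => Num.floor (n.+1%:R * x 0 i)].
apply/countable_injP; exists f => x y; rewrite !inE => Lx Ly.
move=> /(pcan_inj pickleK)/ffunP xy; apply/eqP/negPn/negP => /(uL _ _ Lx Ly).
apply/negP; rewrite -ltNge; apply: (le_lt_trans (enorm_le_sum _)).
have n0 : 0 < n.+1%:R :> R by rewrite ltr0n.
(* Equal integer parts bound each coordinate difference by 1/(n+1), so the total is at most n/(n+1)
   < 1. *)
apply: (@le_lt_trans _ _ (\sum_(i < n) n.+1%:R^-1)).
  apply: ler_sum => i _; rewrite !mxE -[leRHS]mulr1 ler_pdivlMl//.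
  rewrite -{1}[n.+1%:R]gtr0_norm// -normrM mulrBr ler_norml.
  have := floor_itv (n.+1%:R * x 0 i); have := xy i; rewrite !ffunE => ->.
  have := floor_itv (n.+1%:R * y 0 i); rewrite !intrD => /andP[? ?] /andP[? ?].
  by apply/andP; split; lra.
by rewrite sumr_const card_ord -[_ *+ n]mulr_natl ltr_pdivrMr// mul1r ltr_nat.
Qed.

(** The support is a union of closed balls over a countable set of centers. *)
Lemma measurable_support L : uniformly_discrete L ->
  measurable (support_set (packing L)).
Proof.
move=> /countable_uniformly_discrete/countable_injP[f fi].
rewrite support_setE bigcup_set_type; apply: countable_bigcupT_measurable.
  apply/countable_injP; exists (f \o val) => x y _ _ /= fxy.
  by apply/val_inj/fi => //; exact: valP.
by move=> i; exact: measurable_cball.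
Qed.

End packing_support.

(** * Upper limits and convergence in the extended reals *)

Section limsup.
Context {R : realType}.
Implicit Types (f : R -> \bar R) (c : \bar R).

Lemma limf_esup_le f c : (\forall t \near +oo, (f t <= c)%E) ->
  (limf_esup f +oo%R <= c)%E.
Proof.
move=> fc; rewrite limf_esupE; apply: ge_ereal_inf.
exists (ereal_sup (f @` [set t | (f t <= c)%E])); first by exists [set t | (f t <= c)%E].
by apply: ge_ereal_sup => _ [t + <-].
Qed.

Lemma limf_esup_lt f c : (limf_esup f +oo%R < c)%E ->
  \forall t \near +oo, (f t < c)%E.
Proof.
rewrite limf_esupE => /ereal_inf_lt[_ [V Voo <-] Vc].
apply: filterS Voo => t Vt; apply: le_lt_trans Vc.
by apply: le_ereal_sup_tmp; exists (f t) => //; exists t.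
Qed.

Lemma cvge_dist (u : nat -> \bar R) (l : R) :
  (forall e : R, 0 < e -> \forall i \near \oo,
    ((l - e)%:E <= u i <= (l + e)%:E)%E) -> u @ \oo --> l%:E.
Proof.
move=> ul; apply/fine_cvgP; split.
  (* The bound with [e = 1] already makes the terms eventually finite. *)
  apply: filterS (ul _ ltr01) => i /andP[lu ur].
  by rewrite fin_real// (lt_le_trans (ltNyr _) lu) (le_lt_trans ur (ltry _)).
apply/cvgrPdist_le => e e0; apply: filterS (ul _ e0) => i /= /andP[].
case: (u i) => //= r; rewrite !lee_fin => ? ?.
by rewrite ler_norml; apply/andP; split; lra.
Qed.

End limsup.

(** * Density and M1 distance in terms of ball ratios *)

Section density_ratio.
Context {R : realType} {n : nat}.
Implicit Types (L : set 'rV[R]_n) (c : R).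

(** Both functions take only the values 0 and 1, so four cases decide. This turns M1 distances into
    volumes of symmetric differences. *)
Lemma chi_dist L1 L2 x :
  Normc.normc (chi (packing L1) x - chi (packing L2) x) =
  \1_(support_set (packing L1) `+` support_set (packing L2)) x :> R.
Proof.
rewrite /chi !indicE in_setU !in_setD.
by do 2![case: (_ \in _)]; rewrite /= ?subrr ?subr0 ?sub0r ?sqrrN ?expr1n
  expr0n/= ?addr0 ?sqrtr1 ?sqrtr0.
Qed.

(** The radius is halved because the dilate of [halfball] by [t] is the ball of radius [t / 2]. *)
Lemma M1norm_ratio L1 L2 t : uniformly_discrete L1 -> uniformly_discrete L2 ->
  0 < t ->
  ((vol R n ( *:%R t @` @halfball R n))^-1 *
    \int[vol R n]_(x in *:%R t @` @halfball R n)
      (Normc.normc ((chi (packing L1) \- chi (packing L2)) x))%:E)%E =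
  (ball_ratio (support_set (packing L1) `+` support_set (packing L2)) (t / 2))%:E.
Proof.
move=> u1 u2 t0; have mS1 := measurable_support u1; have mS2 := measurable_support u2.
have mY : measurable (support_set (packing L1) `+` support_set (packing L2)).
  by apply: measurableU; exact: measurableD.
rewrite scale_halfball//; under eq_integral => x _ do rewrite [Normc.normc _]chi_dist.
rewrite integral_indic//; last exact: measurable_cball.
by rewrite muleC vol_div_cball// divr_gt0.
Qed.

Lemma M1norm_lt L1 L2 c : uniformly_discrete L1 -> uniformly_discrete L2 ->
  (M1norm (chi (packing L1) \- chi (packing L2))%R < c%:E)%E ->
  \forall t \near +oo,
    ball_ratio (support_set (packing L1) `+` support_set (packing L2)) t < c.
Proof.
(* The eventual bound is used at [t * 2]; taking the maximum with 0 makes [t] positive and [t * 2]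
   larger than [M]. *)
move=> u1 u2 /limf_esup_lt[M [_ hM]]; exists (Num.max M 0).
split=> [|t]; first exact: num_real.
rewrite gt_max => /andP[Mt t0].
have t2 : 0 < t * 2 by rewrite mulr_gt0.
rewrite -lte_fin -[X in ball_ratio _ X](mulfK (x := 2))// -M1norm_ratio//.
by apply: hM; lra.
Qed.

Lemma M1norm_le L1 L2 c : uniformly_discrete L1 -> uniformly_discrete L2 ->
  (\forall t \near +oo,
    ball_ratio (support_set (packing L1) `+` support_set (packing L2)) t <= c) ->
  (M1norm (chi (packing L1) \- chi (packing L2))%R <= c%:E)%E.
Proof.
move=> u1 u2 /near_pinfty_div2 h; apply: limf_esup_le.
near=> t; have t0 : 0 < t by near: t; exact: nbhs_pinfty_gt.
by rewrite M1norm_ratio// lee_fin; near: t.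
Unshelve. all: by end_near. Qed.

Lemma density_lt L c : uniformly_discrete L ->
  (density (packing L) < c%:E)%E ->
  \forall t \near +oo, ball_ratio (support_set (packing L)) t < c.
Proof.
move=> uL /limf_esup_lt h; near=> t.
have t0 : 0 < t by near: t; exact: nbhs_pinfty_gt.
rewrite -lte_fin -vol_div_cball//; last exact: measurable_support.
by near: t.
Unshelve. all: by end_near. Qed.

Lemma density_le L c : uniformly_discrete L ->
  (\forall t \near +oo, ball_ratio (support_set (packing L)) t <= c) ->
  (density (packing L) <= c%:E)%E.
Proof.
move=> uL h; apply: limf_esup_le; near=> t.
have t0 : 0 < t by near: t; exact: nbhs_pinfty_gt.
rewrite vol_div_cball//; last exact: measurable_support.
by rewrite lee_fin; near: t.
Unshelve. all: by end_near. Qed.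

Lemma density_fin L : uniformly_discrete L -> density (packing L) \is a fin_num.
Proof.
move=> uL; rewrite ge0_fin_numE.
  rewrite (le_lt_trans _ (ltry 1))// density_le//; near=> t.
  by apply: ball_ratio_le1; [exact: measurable_support|near: t; exact: nbhs_pinfty_gt].
apply: limf_esup_ge0 => [|t]; first exact: filter_not_empty.
by rewrite mule_ge0// inve_ge0.
Unshelve. all: by end_near. Qed.

Lemma M1norm_ge0 (f : 'rV[R]_n -> R[i]) : (0 <= M1norm f)%E.
Proof.
apply: limf_esup_ge0 => [|t]; first exact: filter_not_empty.
rewrite mule_ge0 ?inve_ge0//; apply: integral_ge0 => x _.
by rewrite lee_fin; case: (f x) => a b /=; exact: sqrtr_ge0.
Qed.

(** The first support lies in the union of the second one and the symmetric difference. The slack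
    [e] is there because the second ratio is only eventually below its upper limit plus [e]. *)
Lemma density_le_M1norm L1 L2 c : uniformly_discrete L1 -> uniformly_discrete L2 ->
  (M1norm (chi (packing L1) \- chi (packing L2))%R < c%:E)%E ->
  (density (packing L1) <= density (packing L2) + c%:E)%E.
Proof.
move=> u1 u2 /(M1norm_lt u1 u2) h; rewrite -(fineK (density_fin u2)) -EFinD.
have mS1 := measurable_support u1; have mS2 := measurable_support u2.
have mY : measurable (support_set (packing L1) `+` support_set (packing L2)).
  by apply: measurableU; exact: measurableD.
apply/lee_addgt0Pr => e e0; rewrite -EFinD; apply: density_le => //.
have /(density_lt u2) h2 : (density (packing L2) < (fine (density (packing L2)) + e)%:E)%E.
  by rewrite EFinD fineK ?density_fin// lteDl ?density_fin.
near=> t; have t0 : 0 < t by near: t; exact: nbhs_pinfty_gt.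
have r2 : ball_ratio (support_set (packing L2)) t < fine (density (packing L2)) + e by near: t.
have r12 : ball_ratio (support_set (packing L1) `+` support_set (packing L2)) t < c.
  by near: t.
apply: (@le_trans _ _ (ball_ratio (support_set (packing L2) `|`
   (support_set (packing L1) `+` support_set (packing L2))) t)).
  apply: le_ball_ratio => //; first exact: measurableU.
  by move=> x [x1 _]; have [x2|x2] := pselect (support_set (packing L2) x); [left|right; left].
apply: (le_trans (ball_ratioU mS2 mY t0)); lra.
Unshelve. all: by end_near. Qed.

End density_ratio.

(** * Thin spherical shells are negligible *)

Section shell.
Context {R : realType}.

(** Bernoulli's inequality, in the form that bounds the relative volume of a shell. *)
Lemma subr1X_le (x : R) n : 0 <= x <= 1 -> 1 - x ^+ n <= n%:R * (1 - x).
Proof.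
move=> /andP[x0 x1]; elim: n => [|n IHn]; first by rewrite expr0 subrr mul0r.
by have xn1 : x ^+ n <= 1; [exact: exprn_ile1|rewrite exprS -natr1; nra].
Qed.

(** The ratio is largest at [t = s], where it equals [1 - (r / s) ^+ n]: a larger ball dilutes the
    shell, and a smaller one cuts it down to a relatively thinner shell. Bernoulli's inequality then
    applies. *)
Lemma ball_ratio_shell_le n (r s t : R) : 0 < r -> r <= s -> r <= t ->
  ball_ratio (cball (0 : 'rV[R]_n) s `\` cball 0 r) t <= n%:R * ((s - r) / s).
Proof.
move=> r0 rs rt; have s0 := lt_le_trans r0 rs; have t0 := lt_le_trans r0 rt.
have mc u := @measurable_cball R n 0 u.
have rs1 : 0 <= r / s <= 1 by rewrite divr_ge0 ?(ltW r0) ?(ltW s0) ?(ltW t0)//= ler_pdivrMr// mul1r.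
rewrite mulrBl divff ?gt_eqF//; apply: le_trans (subr1X_le n rs1).
have [st|/ltW ts] := leP s t.
  rewrite ball_ratio_shell ?r0//.
  have -> : r / t = (s / t) * (r / s) by field; rewrite !gt_eqF.
  rewrite [(_ * (r / s)) ^+ n]exprMn -{1}[(s / t) ^+ n]mulr1 -mulrBr ler_piMl//.
    by rewrite subr_ge0 exprn_ile1//; case/andP: rs1.
  by rewrite exprn_ile1 ?divr_ge0 ?(ltW r0) ?(ltW s0) ?(ltW t0)// ler_pdivrMr// mul1r.
apply: (@le_trans _ _ (ball_ratio (cball (0 : 'rV[R]_n) t `\` cball 0 r) t)).
  by apply: le_ball_ratio => //; [exact: measurableD|exact: measurableD|move=> x [[]]].
rewrite ball_ratio_shell ?r0// divff ?gt_eqF// expr1n lerB//.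
by rewrite lerXn2r ?nnegrE ?divr_ge0 ?(ltW r0) ?(ltW s0) ?(ltW t0)// ler_wpM2l ?(ltW r0)// lef_pV2.
Qed.

End shell.

(** * The glued set and its distance to each term of the sequence *)

Section annular_union.
Context {R : realType} {n : nat}.
Variables (K : nat -> set 'rV[R]_n) (lam : nat -> R).
Hypothesis uK : forall i, uniformly_discrete (K i).
Hypothesis lam_homo : {homo lam : i j / (i <= j)%N >-> i <= j}.

Definition annular_union := \bigcup_(i in [set i | (1 <= i)%N])
  (K i `&` annulus (lam i + 2^-1) (lam i.+1 - 2^-1)).

(** As [lam i.+1 <= lam j], the margins of 1/2 on either side add up to a gap of width 1. *)
Lemma annulus_gap i j (x y : 'rV[R]_n) : (i < j)%N ->
  annulus (lam i + 2^-1) (lam i.+1 - 2^-1) x ->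
  annulus (lam j + 2^-1) (lam j.+1 - 2^-1) y -> 1 <= enorm y - enorm x.
Proof.
by move=> /lam_homo ij /andP[_ xi] /andP[yj _]; lra.
Qed.

Lemma uniformly_discrete_annular_union : uniformly_discrete annular_union.
Proof.
move=> x y [i _ [Kx ax]] [j _ [Ky ay]] xy.
have [ij|ij|ij] := ltngtP i j.
- rewrite -enormN opprB; apply: le_trans (enormB_ge _ _).
  exact: annulus_gap ij ax ay.
- by apply: le_trans (enormB_ge _ _); exact: annulus_gap ij ay ax.
- by apply: (uK (i := i)) => //; rewrite ij.
Qed.

(** A ball of radius 1/2 containing [x] has its center in the [k]-th annulus, where the glued set
    and [K k] coincide. *)
Lemma support_annular_union k x : (1 <= k)%N ->
  lam k + 1 <= enorm x <= lam k.+1 - 1 ->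
  support_set (packing annular_union) x <-> support_set (packing (K k)) x.
Proof.
move=> k1 /andP[kx xk]; rewrite !support_setE.
have near_annulus l : cball l 2^-1 x -> annulus (lam k + 2^-1) (lam k.+1 - 2^-1) l.
  rewrite /cball /annulus /= => lx; have := enormB_ge x l; have := enormB_ge l x.
  by rewrite -[enorm (l - x)]enormN opprB => ? ?; apply/andP; split; lra.
split=> -[l].
- move=> [i _ [Kl al]] xl; have ak := near_annulus l xl.
  (* A center [l] in two different annuli would be separated from itself by the gap of width 1. *)
  have [ik|ik|ik] := ltngtP i k; last by exists l; rewrite -?ik.
  + by have := annulus_gap ik al ak; rewrite subrr ler10.
  + by have := annulus_gap ik ak al; rewrite subrr ler10.
- by move=> Kl xl; exists l => //; exists k => //; split=> //; exact: near_annulus.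
Qed.

Local Notation S := (support_set (packing annular_union)).
Local Notation S_ i := (support_set (packing (K i))).

(** Split according to [enorm x]: on the two ranges away from the radii, [support_annular_union]
    replaces the glued packing by the one of index [k] or [k.+1]. *)
Lemma symdiff_annular_union i k t : (1 <= k)%N ->
  lam k.+1 <= t <= lam k.+2 ->
  (S `+` S_ i) `&` cball 0 t `<=`
    cball 0 (lam k + 1) `|` (S_ k `+` S_ i) `|` (S_ k.+1 `+` S_ i) `|`
    (cball 0 (lam k.+1 + 1) `\` cball 0 (lam k.+1 - 1)) `|`
    (cball 0 t `\` cball 0 (t - 1)).
Proof.
move=> k1 /andP[kt tk] x [dx]; rewrite /setD !cball0E /= => xt.
have [|xk] := leP (enorm x) (lam k + 1); first by move=> ?; do 4 left.
have [xk1|xk1] := leP (enorm x) (lam k.+1 - 1).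
  have /support_annular_union h : lam k + 1 <= enorm x <= lam k.+1 - 1.
    by rewrite xk1 ltW.
  by do 3 left; right; move: dx; rewrite /setY /= h.
have [xk2|xk2] := leP (enorm x) (lam k.+1 + 1).
  by left; right; split => //; apply/negP; rewrite -ltNge.
have [xk3|xk3] := leP (enorm x) (lam k.+2 - 1).
  have /(support_annular_union (isT : (1 <= k.+1)%N)) h :
    lam k.+1 + 1 <= enorm x <= lam k.+2 - 1 by rewrite xk3 ltW.
  by do 2 left; right; move: dx; rewrite /setY /= h.
(* Here [enorm x > lam k.+2 - 1 >= t - 1]. *)
by right; split => //; apply/negP; rewrite -ltNge; lra.
Qed.

Hypothesis n1 : (1 <= n)%N.
Hypothesis lam_ge1 : forall i, 1 <= lam i.
Hypothesis lam_growth : forall i, 2 ^+ i.+1 * (lam i + 1) <= lam i.+1.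
Hypothesis lam_symdiff : forall i j t, (i <= j)%N -> lam j <= t ->
  ball_ratio (S_ j `+` S_ i) t <= 2^-1 ^+ i.

(** Gives the unboundedness of the radii that [window_of] relies on. *)
Lemma lam_ge_exp i : 2 ^+ i <= lam i.
Proof.
case: i => [|i]; first by rewrite expr0.
apply: le_trans (lam_growth i); rewrite ler_peMr ?exprn_ge0//.
by have := lam_ge1 i; lra.
Qed.

(** The inner ball costs 2^-k, the two symmetric differences 2^-i each, and the shells of widths 2
    and 1 cost 2n 2^-k and n 2^-k. *)
Lemma ball_ratio_annular_union_window i k t : (1 <= k)%N -> (i <= k)%N ->
  lam k.+1 <= t <= lam k.+2 ->
  ball_ratio (S `+` S_ i) t <=
    (1 + 3 * n%:R) * 2^-1 ^+ k + 2 * 2^-1 ^+ i.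
Proof.
move=> k1 ik tk; have /andP[kt _] := tk.
have mS : measurable S by exact: measurable_support uniformly_discrete_annular_union.
have mS_ j : measurable (S_ j) by exact: measurable_support (@uK j).
have mY (A B : set 'rV[R]_n) : measurable A -> measurable B -> measurable (A `+` B).
  by move=> mA mB; apply: measurableU; exact: measurableD.
have mc u := @measurable_cball R n 0 u.
have l1 := lam_ge1 k.
have p0 : 0 < 2^-1 ^+ k :> R by rewrite exprn_gt0// invr_gt0.
have p1 : 2^-1 ^+ k <= 1 :> R by apply: exprn_ile1; lra.
(* The growth condition divided by 2^k; every bound by 2^-k below comes from it. *)
have pk : 2^-1 ^+ k * lam k.+1 >= 2 * (lam k + 1).
  have := lam_growth k; rewrite exprS -mulrA => h.
  have := ler_wpM2l (ltW p0) h; rewrite mulrCA [X in _ * X <= _]mulrA -exprMn.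
  by rewrite mulVf// expr1n mul1r.
(* Keeps the inner radii [lam k.+1 - 1] and [t - 1] of the shells positive. *)
have lk1 : 4 <= lam k.+1 by nra.
have t0 : 0 < t by lra.
have n0 : 0 <= n%:R :> R by [].
have b1 : ball_ratio (cball (0 : 'rV[R]_n) (lam k + 1)) t <= 2^-1 ^+ k.
  have lt1 : (lam k + 1) / t <= 2^-1 ^+ k by rewrite ler_pdivrMr//; nra.
  rewrite ball_ratio_cball; last by apply/andP; split; nra.
  (* Since n is positive, one factor of the n-th power carries the bound and the others are at most
     1. *)
  apply: le_trans lt1; rewrite -(prednK n1) exprS ler_piMr//.
    by rewrite divr_ge0//; lra.
  by rewrite exprn_ile1 ?divr_ge0 ?ler_pdivrMr ?mul1r//; nra.
have b2 := lam_symdiff ik (le_trans (lam_homo (leqnSn k)) kt).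
have b3 := lam_symdiff (leqW ik) kt.
have ti : t^-1 <= 2^-1 ^+ k.
  rewrite -div1r ler_pdivrMr//; nra.
have b4 : ball_ratio (cball (0 : 'rV[R]_n) (lam k.+1 + 1) `\` cball 0 (lam k.+1 - 1)) t
    <= n%:R * (2 * 2^-1 ^+ k).
  apply: (le_trans (ball_ratio_shell_le n _ _ _)); [lra|lra|lra|].
  by rewrite ler_wpM2l// ler_pdivrMr; nra.
have b5 : ball_ratio (cball (0 : 'rV[R]_n) t `\` cball 0 (t - 1)) t <= n%:R * 2^-1 ^+ k.
  apply: (le_trans (ball_ratio_shell_le n _ _ _)); [lra|lra|lra|].
  by rewrite ler_wpM2l// subKr div1r.
have mU (A B C D F : set 'rV[R]_n) : measurable A -> measurable B -> measurable C ->
    measurable D -> measurable F ->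
    ball_ratio (A `|` B `|` C `|` D `|` F) t <= ball_ratio A t + ball_ratio B t +
      ball_ratio C t + ball_ratio D t + ball_ratio F t.
  move=> mA mB mC mD mF.
  have mAB := measurableU _ _ mA mB; have mABC := measurableU _ _ mAB mC.
  have mABCD := measurableU _ _ mABC mD.
  by do 4![apply: (le_trans (ball_ratioU _ _ t0)) => //; rewrite lerD2r].
apply: (le_trans (le_ball_ratio _ _ t0 (symdiff_annular_union k1 tk))); first exact: mY.
  by do 4?apply: measurableU => //; do ?[exact: measurableD|exact: mY].
have mAB r s := measurableD (mc r) (mc s).
apply: (le_trans (mU _ _ _ _ _ (mc _) (mY _ _ (mS_ _) (mS_ _)) (mY _ _ (mS_ _) (mS_ _))
  (mAB _ _) (mAB _ _))).
rewrite mulrDl mul1r; lra.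
Qed.

Lemma window_of (k : nat) t : lam k <= t ->
  exists2 j, (k <= j)%N & lam j <= t <= lam j.+1.
Proof.
move=> kt; have ex : exists j, t < lam j.
  exists (Num.bound t); apply: lt_le_trans (lam_ge_exp _).
  apply: (lt_trans (archi_boundP _)); first by have := lam_ge1 k; lra.
  by rewrite -natrX ltr_nat ltn_expl.
(* The least index whose radius exceeds [t] is greater than [k], so it has a predecessor, which is
   the wanted index. *)
case: (ex_minnP ex) => j tj jmin.
have kj : (k < j)%N.
  by rewrite ltnNge; apply/negP => /lam_homo; rewrite leNgt (le_lt_trans kt tj).
case: j tj jmin kj => // j tj jmin kj; exists j => //; rewrite (ltW tj) andbT leNgt.
by apply/negP => /jmin; rewrite ltnn.
Qed.

Lemma ball_ratio_annular_union i :
  \forall t \near +oo, ball_ratio (S `+` S_ i) t <= 3 * 2^-1 ^+ i.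
Proof.
(* From here on the window index [j] is at least i + 3n + 1, and 2^(3n+1) absorbs the factor 1 + 3n,
   leaving 2^-i. The outer successor accounts for windows starting at [lam j.+1]. *)
exists (lam (i + (3 * n).+1).+1); split=> [|t /ltW]; first exact: num_real.
move=> /window_of[[//|j]]; rewrite ltnS => ij tj.
apply: (le_trans (ball_ratio_annular_union_window (k := j) _ _ tj)).
- by apply: leq_trans ij; rewrite addnS.
- by apply: leq_trans ij; exact: leq_addr.
suff : (1 + 3 * n%:R) * 2^-1 ^+ j <= 2^-1 ^+ i :> R by lra.
have q : (1 + 3 * n%:R) * 2^-1 ^+ (3 * n).+1 <= 1 :> R.
  rewrite exprVn ler_pdivrMr ?exprn_gt0// mul1r -natrM -natrX addrC natr1 ler_nat.
  by rewrite ltnW// ltn_expl.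
have p0 : 0 <= 2^-1 ^+ i :> R by rewrite exprn_ge0// invr_ge0.
have : 2^-1 ^+ j <= 2^-1 ^+ (i + (3 * n).+1) :> R by rewrite ler_wiXn2l//; lra.
have n0 : 0 <= 1 + 3 * n%:R :> R by rewrite addr_ge0// mulr_ge0.
rewrite exprD => /(ler_wpM2l n0)/le_trans; apply.
by rewrite mulrCA ler_piMr.
Qed.

End annular_union.

(** * Choice of the subsequence and of the radii *)

Section subsequence.
Context {R : realType} {n : nat}.

Lemma M1_cauchy_subsequence (u : nat -> 'rV[R]_n -> R[i]) : M1_cauchy u ->
  exists m_ : nat -> nat, [/\ forall i, (0 < m_ i)%N,
    forall i, (m_ i < m_ i.+1)%N &
    forall i j, (i <= j)%N ->
      (M1norm (u (m_ j) \- u (m_ i))%R < (2^-1 ^+ i)%:E)%E].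
Proof.
move=> uC.
have /choice[N hN] : forall i, exists N, forall p q, (N <= p)%N -> (N <= q)%N ->
    (M1norm (u p \- u q)%R < (2^-1 ^+ i)%:E)%E.
  by move=> i; apply: uC; rewrite exprn_gt0// invr_gt0.
(* Partial sums of positive terms are positive, strictly increasing and larger than [N i]. *)
pose m_ i := (\sum_(j < i.+1) (N j).+1)%N.
have mS i : m_ i.+1 = (m_ i + (N i.+1).+1)%N by rewrite /m_ big_ord_recr.
have mN i : (N i < m_ i)%N.
  by case: i => [|i]; rewrite ?mS ?leq_addl// /m_ big_ord1.
have m_homo : {homo m_ : i j / (i <= j)%N}.
  by apply: homo_leq => // [? ? ?|i]; [exact: leq_trans|rewrite mS leq_addr].
exists m_; split=> [i|i|i j ij].
- exact: leq_ltn_trans (mN i).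
- by rewrite mS addnS ltnS leq_addr.
- apply: hN; last exact: ltnW.
  exact: leq_trans (ltnW (mN i)) (m_homo _ _ ij).
Qed.

Lemma fast_growing_radii (tau : nat -> R) : exists lam : nat -> R,
  [/\ forall i, 1 <= lam i, forall i, 2 ^+ i.+1 * (lam i + 1) <= lam i.+1 &
      forall i, tau i < lam i].
Proof.
(* The summand [|tau i|] pushes the radius past [tau i]; strictness comes from the other, positive
   summand. *)
pose lam := fix lam i := if i is k.+1 then 2 ^+ k.+1 * (lam k + 1) + `|tau k.+1|
  else 1 + `|tau 0%N|.
have lam1 i : 1 <= lam i.
  elim: i => [|i IHi] /=; first by rewrite lerDl.
  rewrite ler_wpDr// (le_trans (_ : 1 <= lam i + 1)) ?lerDr ?(le_trans _ IHi)//.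
  by rewrite ler_peMl ?exprn_ege1 ?addr_ge0 ?(le_trans _ IHi)// ler1n.
exists lam; split=> // [i|[|i]] /=; first by rewrite lerDl.
- by rewrite (le_lt_trans (ler_norm _))// ltrDr.
- rewrite (le_lt_trans (ler_norm _))// ltrDr mulr_gt0 ?exprn_gt0//.
  by rewrite (lt_le_trans _ (_ : 1 <= lam i + 1)) ?lerDr ?(le_trans _ (lam1 i)).
Qed.

Lemma symdiff_threshold (K : nat -> set 'rV[R]_n) :
  (forall i, uniformly_discrete (K i)) ->
  (forall i j, (i <= j)%N ->
    (M1norm (chi (packing (K j)) \- chi (packing (K i)))%R < (2^-1 ^+ i)%:E)%E) ->
  exists tau : nat -> R, forall i j t, (i <= j)%N -> tau j < t ->
    ball_ratio (support_set (packing (K j)) `+` support_set (packing (K i))) t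
      <= 2^-1 ^+ i.
Proof.
move=> uK hK.
(* For fixed [j] only the finitely many indices [i <= j] matter, so one threshold serves them
   all. *)
suff /choice[tau htau] : forall j, exists tau : R, forall t, tau < t ->
    forall i : 'I_j.+1,
    ball_ratio (support_set (packing (K j)) `+` support_set (packing (K i))) t
      <= 2^-1 ^+ i.
  by exists tau => i j t ij jt; exact: (htau j t jt (Ordinal (ij : i < j.+1)%N)).
move=> j; have [M [_ hM]] : \forall t \near +oo%R, forall i : 'I_j.+1,
    ball_ratio (support_set (packing (K j)) `+` support_set (packing (K i))) t
      <= 2^-1 ^+ i.
  apply: filter_forall => i.
  have := hK _ _ (ltn_ord i : (i <= j)%N).
  by move=> /(M1norm_lt (uK j) (uK i)); apply: filterS => t /ltW.
by exists M.
Qed.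

End subsequence.

(** * From geometric error bounds to the two limits *)

Lemma near_geometric_le {R : realType} (c e : R) : 0 < e ->
  \forall i \near \oo, c * 2^-1 ^+ i <= e.
Proof.
move=> e0.
have /cvgrPdist_le/(_ _ e0) : (fun i => c * 2^-1 ^+ i : R) @ \oo --> (0 : R).
  by apply: cvg_geometric; rewrite ger0_norm// invf_lt1// ltr1n.
by apply: filterS => i; rewrite sub0r normrN; apply: le_trans (ler_norm _).
Qed.

Unset Implicit Arguments.

Theorem theorem1p2 (R : realType) (n : nat) (L : nat -> set 'rV[R]_n) :
  (1 <= n)%N ->
  (forall m, (1 <= m)%N -> uniformly_discrete (L m)) ->
  M1_cauchy (fun m => chi (packing (L m))) ->
  exists (m_ : nat -> nat) (lam : nat -> R),
    [/\ forall i, (1 <= i)%N -> (1 <= m_ i)%N,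
        forall i, (1 <= i)%N -> (m_ i < m_ i.+1)%N,
        forall i, (1 <= i)%N -> 1 <= lam i,
        forall i, (1 <= i)%N -> lam i < lam i.+1 &
        forall i, (1 <= i)%N -> 2 * lam i < lam i.+1] /\
    let Lam := \bigcup_(i in [set i | (1 <= i)%N])
      (L (m_ i) `&` annulus (lam i + 2^-1) (lam i.+1 - 2^-1)) in
    [/\ uniformly_discrete Lam,
        (fun i => M1norm (chi (packing Lam) \- chi (packing (L (m_ i)))))
          @ \oo --> 0%E &
        (fun i => density (packing (L (m_ i)))) @ \oo --> density (packing Lam)].
Proof.
move=> n1 uL /M1_cauchy_subsequence[m_ [m_gt0 m_lt m_cauchy]].
(* Every [m_ i] is positive, [i = 0] included, so the hypothesis on [L] covers all [K i]. *)
pose K i := L (m_ i); have uK i : uniformly_discrete (K i) by exact/uL/m_gt0.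
have [tau htau] := symdiff_threshold uK m_cauchy.
have [lam [lam_ge1 lam_growth lam_tau]] := fast_growing_radii tau.
have lam2 i : 2 * lam i < lam i.+1.
  apply: lt_le_trans (lam_growth i); rewrite exprS -mulrA ltr_pM2l//.
  have := lam_ge1 i; have : 1 <= 2 ^+ i :> R by rewrite exprn_ege1// ler1n.
  by nra.
have lam_lt i : lam i < lam i.+1 by have := lam2 i; have := lam_ge1 i; lra.
have lam_homo : {homo lam : i j / (i <= j)%N >-> i <= j}.
  by apply: homo_leq => // [? ? ?|i]; [exact: le_trans|exact: ltW].
have uLam := uniformly_discrete_annular_union uK lam_homo.
(* The strict bound [tau j < lam j] lets the threshold apply from [lam j] on, endpoint included. *)
have hratio := ball_ratio_annular_union uK lam_homo n1 lam_ge1 lam_growth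
  (fun i j t ij jt => htau i j t ij (lt_le_trans (lam_tau j) jt)).
exists m_, lam; split=> // Lam.
have M1l i := M1norm_le uLam (uK i) (hratio i).
(* The density comparison is needed in both directions; the symmetric difference is commutative. *)
have M1r i : (M1norm (chi (packing (K i)) \- chi (packing Lam))%R <= (3 * 2^-1 ^+ i)%:E)%E.
  by apply: M1norm_le => //; rewrite setYC; exact: hratio.
(* [density_le_M1norm] asks for a strict bound, hence 4 in place of 3. *)
have lt34 i : ((3 * 2^-1 ^+ i)%:E < (4 * 2^-1 ^+ i : R)%:E)%E.
  by rewrite lte_fin ltr_pM2r ?exprn_gt0 ?invr_gt0// ltr_nat.
split=> //.
- apply: cvge_dist => e e0; apply: filterS (near_geometric_le 3 e0) => i ie.
  rewrite sub0r add0r (le_trans (M1l i)) ?lee_fin// andbT.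
  by rewrite (le_trans _ (M1norm_ge0 _))// lee_fin oppr_le0 ltW.
- rewrite -(fineK (density_fin uLam)); apply: cvge_dist => e e0.
  apply: filterS (near_geometric_le 4 e0) => i ie; apply/andP; split.
    rewrite EFinB fineK ?density_fin// leeBlDr//.
    apply: le_trans (density_le_M1norm uLam (uK i) (le_lt_trans (M1l i) (lt34 i))) _.
    by rewrite leeD2l// lee_fin.
  rewrite EFinD fineK ?density_fin//.
  apply: le_trans (density_le_M1norm (uK i) uLam (le_lt_trans (M1r i) (lt34 i))) _.
  by rewrite leeD2l// lee_fin.
Qed.
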